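(* Let $(\mathcal{I},v)$ be a transferable utility coalitional game with $\mathcal{I}=\{1,\dots,N\}$ whose CORE $\mathcal{C}\subset\mathbb{R}^N$ is non-empty, and let $\beta\in[0,1)$. For each $i\in\mathcal{I}$ define $\mathcal{T}_i:\mathbb{R}^N\to\mathbb{R}^N$ by $$\mathcal{T}_i(w) := (1-\beta)\,\mathrm{proj}_{\mathcal{C}}(w)+\beta\,Q_{\mathcal{C}}(w),\qquad Q_{\mathcal{C}} := 2\,\mathrm{proj}_{\mathcal{C}}-\mathrm{Id},$$ and define $\mathcal{T}:\mathbb{R}^{N^2}\to\mathbb{R}^{N^2}$ by $\mathcal{T}(\mathrm{col}(w_1,\dots,w_N)) := \mathrm{col}(\mathcal{T}_1(w_1),\dots,\mathcal{T}_N(w_N))$, where $w_1,\dots,w_N\in\mathbb{R}^N$. Then $\mathcal{T}$ is a paracontraction with respect to the Euclidean norm on $\mathbb{R}^{N^2}$.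
   Context: A transferable utility coalitional game is a pair $(\mathcal{I},v)$ with $\mathcal{I}=\{1,\dots,N\}$ and $v$ a function assigning a real value $v(S)$ to each $S\subseteq\mathcal{I}$, with $v(\varnothing)=0$. Its CORE is $$\mathcal{C}=\Big\{x\in\mathbb{R}^N \;\Big|\; \sum_{i\in\mathcal{I}}x_i=v(\mathcal{I}),\ \sum_{i\in S}x_i\ge v(S)\ \text{for all } S\subseteq\mathcal{I}\Big\},$$ a closed convex set, which is assumed non-empty. $\mathrm{proj}_{\mathcal{C}}(x)=\arg\min_{y\in\mathcal{C}}\|y-x\|$ is the Euclidean projection onto $\mathcal{C}$; $\mathrm{Id}$ is the identity operator; $\mathrm{col}(\cdot)$ stacks vectors into one column vector. For a mapping $M:\mathbb{R}^n\to\mathbb{R}^n$, $\mathrm{fix}(M)=\{x\in\mathbb{R}^n\mid x=M(x)\}$. A continuous mapping $M:\mathbb{R}^n\to\mathbb{R}^n$ is a paracontraction with respect to a norm $\|\cdot\|$ if $\|M(x)-y\|<\|x-y\|$ for all $x\notin\mathrm{fix}(M)$ and $y\in\mathrm{fix}(M)$. *)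

(* Defs.v *)
From mathcomp Require Import all_boot all_order all_algebra.
From mathcomp Require Import all_classical all_reals all_analysis.

Set Implicit Arguments.
Unset Strict Implicit.
Unset Printing Implicit Defensive.

Import Order.TTheory GRing.Theory Num.Theory.
Import numFieldNormedType.Exports.

Local Open Scope classical_set_scope.
Local Open Scope ring_scope.

(* Vectors of R^n are columns.  The library norm `|x| on matrices is the sup
   norm, hence a separate Euclidean norm; the library topology on 'cV[R]_n
   (entrywise, from R) is the usual one of R^n. *)
Definition enorm (R : realType) (n : nat) (x : 'cV[R]_n) : R :=
  Num.sqrt (\sum_(i < n) x i 0 ^+ 2).

Definition argmin (R : realType) (T : Type) (A : set T) (f : T -> R) : set T :=
  [set y | A y /\ forall z, A z -> f y <= f z].

(* On a nonempty closed convex C the minimizer exists and is unique, so the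
   value picked by xget is the minimizer; the default 0 is returned only when
   there is no minimizer. *)
Definition proj (R : realType) (n : nat) (C : set 'cV[R]_n) (x : 'cV[R]_n) :
    'cV[R]_n :=
  xget 0 (argmin C (fun y => enorm (y - x))).

Definition overproj (R : realType) (n : nat) (C : set 'cV[R]_n)
    (x : 'cV[R]_n) : 'cV[R]_n :=
  2 *: proj C x - x.

Definition fix_set (R : realType) (n : nat) (M : 'cV[R]_n -> 'cV[R]_n) :
    set 'cV[R]_n :=
  [set x | x = M x].

Definition paracontraction (R : realType) (n : nat) (nrm : 'cV[R]_n -> R)
    (M : 'cV[R]_n -> 'cV[R]_n) : Prop :=
  continuous M /\
  forall x y, ~ fix_set M x -> fix_set M y -> nrm (M x - y) < nrm (x - y).

(* The players are the elements of 'I_N, numbered from 0; coalitions are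
   finite sets of players ({set 'I_N}, not classical sets). *)
Record tu_game (R : realType) (N : nat) := TUGame {
  value :> {set 'I_N} -> R;
  value_empty : value finset.set0 = 0
}.

Definition core (R : realType) (N : nat) (v : tu_game R N) : set 'cV[R]_N :=
  [set x | \sum_(i < N) x i 0 = v (finset.setTfor 'I_N) /\
           forall S : {set 'I_N}, v S <= \sum_(i in S) x i 0].

(* Entry j of w_i is entry i * N + j of the stacked vector: mxvec is
   row-major. *)
Definition stack (R : realType) (N : nat) (w : 'I_N -> 'cV[R]_N) :
    'cV[R]_(N * N) :=
  (mxvec (\matrix_(i < N, j < N) w i j 0))^T.

Definition block (R : realType) (N : nat) (x : 'cV[R]_(N * N)) (i : 'I_N) :
    'cV[R]_N :=
  (row i (vec_mx x^T))^T.

Lemma stackK (R : realType) (N : nat) (w : 'I_N -> 'cV[R]_N) (i : 'I_N) :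
  block (stack w) i = w i.
Proof.
by apply/matrixP => j k; rewrite /block /stack trmxK mxvecK !mxE ord1.
Qed.

Lemma blockK (R : realType) (N : nat) (x : 'cV[R]_(N * N)) :
  stack (block x) = x.
Proof.
rewrite /stack -[RHS]trmxK -[x^T in RHS]vec_mxK; congr (mxvec _)^T.
by apply/matrixP => i j; rewrite !mxE.
Qed.

Definition player_op (R : realType) (N : nat) (v : tu_game R N) (beta : R)
    (i : 'I_N) (w : 'cV[R]_N) : 'cV[R]_N :=
  (1 - beta) *: proj (core v) w + beta *: overproj (core v) w.

Definition joint_op (R : realType) (N : nat) (v : tu_game R N) (beta : R)
    (x : 'cV[R]_(N * N)) : 'cV[R]_(N * N) :=
  stack (fun i => player_op v beta i (block x i)).

Lemma joint_op_stack (R : realType) (N : nat) (v : tu_game R N) (beta : R)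
    (w : 'I_N -> 'cV[R]_N) :
  joint_op v beta (stack w) = stack (fun i => player_op v beta i (w i)).
Proof. by congr stack; apply/funext => i; rewrite stackK. Qed.

(* Main.v *)
(** The projection [P] onto a nonempty closed convex set is firmly nonexpansive:
    [|Px - Py|^2 <= <Px - Py, x - y>].  Each block of the operator is
    [T = (1 + beta) P - beta Id], so expanding the square and using firm
    nonexpansiveness twice yields
    [|Tx - Ty|^2 <= |x - y|^2 - (1 - beta^2) |(x - Px) - (y - Py)|^2].
    Moreover [fix T = fix P].  Summing over the blocks, nonexpansiveness gives
    continuity, and if [y] is fixed the defect is [sum_i |x_i - P x_i|^2], which
    is positive unless [x] is fixed. *)
Require Import Defs.
From mathcomp Require Import all_boot all_order all_algebra.
From mathcomp Require Import all_classical all_reals all_analysis.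
From mathcomp Require Import ring lra.

Import Order.TTheory GRing.Theory Num.Theory.
Import numFieldNormedType.Exports.
(* [proj] also names the canonical projections of MathComp-Analysis. *)
Import Defs.

Local Open Scope classical_set_scope.
Local Open Scope ring_scope.

Set Implicit Arguments.
Unset Strict Implicit.
Unset Printing Implicit Defensive.

(** * Euclidean inner product and norm, compared with the sup norm *)

Section InnerProduct.
Variables (R : realType) (n : nat).
Implicit Types (x y z : 'cV[R]_n) (a : R).

Definition dot x y : R := \sum_(i < n) x i 0 * y i 0.

Lemma dotC x y : dot x y = dot y x.
Proof. by apply: eq_bigr => i _; rewrite mulrC. Qed.

Lemma dotDl x y z : dot (x + y) z = dot x z + dot y z.
Proof. by rewrite -big_split; apply: eq_bigr => i _; rewrite mxE mulrDl. Qed.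

Lemma dotZl a x y : dot (a *: x) y = a * dot x y.
Proof. by rewrite mulr_sumr; apply: eq_bigr => i _; rewrite mxE mulrA. Qed.

Lemma dotNl x y : dot (- x) y = - dot x y.
Proof. by rewrite -scaleN1r dotZl mulN1r. Qed.

Lemma dotDr x y z : dot x (y + z) = dot x y + dot x z.
Proof. by rewrite dotC dotDl !(dotC x). Qed.

Lemma dotZr a x y : dot x (a *: y) = a * dot x y.
Proof. by rewrite dotC dotZl dotC. Qed.

Lemma dotNr x y : dot x (- y) = - dot x y.
Proof. by rewrite dotC dotNl dotC. Qed.

Definition dot_linear := (dotDl, dotDr, dotNl, dotNr, dotZl, dotZr).

Lemma dot_ge0 x : 0 <= dot x x.
Proof. by apply: sumr_ge0 => i _; rewrite -expr2 sqr_ge0. Qed.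

Lemma dot_eq0 x : dot x x = 0 -> x = 0.
Proof.
move=> /eqP; rewrite psumr_eq0 => [/allP x0|i _]; last first.
  by rewrite -expr2 sqr_ge0.
apply/matrixP => i j; rewrite ord1 mxE; apply/eqP.
by have := x0 i (mem_index_enum i); rewrite /= mulf_eq0 orbb.
Qed.

Lemma enormE x : enorm x = Num.sqrt (dot x x).
Proof. by congr Num.sqrt; apply: eq_bigr => i _; rewrite expr2. Qed.

Lemma le_enorm x y : (enorm x <= enorm y) = (dot x x <= dot y y).
Proof. by rewrite !enormE ler_sqrt // dot_ge0. Qed.

Lemma lt_enorm x y : dot x x < dot y y -> enorm x < enorm y.
Proof. by move=> xy; rewrite !enormE ltr_sqrt// (le_lt_trans (dot_ge0 x)). Qed.

Lemma coord_le_enorm x i : `|x i 0| <= enorm x.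
Proof.
rewrite -sqrtr_sqr ler_sqrt; last by apply: sumr_ge0 => j _; rewrite sqr_ge0.
by rewrite (bigD1 i)//= lerDl sumr_ge0// => j _; rewrite sqr_ge0.
Qed.

(** A crude constant suffices; [n.+1], unlike [n], can be divided by even in dimension 0. *)
Lemma enorm_le_coord x a :
  0 <= a -> (forall i, `|x i 0| <= a) -> enorm x <= n.+1%:R * a.
Proof.
move=> a0 xa; rewrite -[leRHS]ger0_norm ?mulr_ge0// -sqrtr_sqr.
rewrite ler_sqrt ?sqr_ge0//.
apply: (@le_trans _ _ (\sum_(i < n) a ^+ 2)).
  apply: ler_sum => i _; rewrite -[leLHS]real_normK ?num_real//.
  by rewrite lerXn2r// nnegrE.
rewrite sumr_const card_ord -[leLHS]mulr_natl exprMn ler_wpM2r ?sqr_ge0//.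
by rewrite -natrX ler_nat (leq_trans (leqnSn n))// leq_pmulr.
Qed.

Lemma continuous_dot (f g : 'cV[R]_n -> 'cV[R]_n) :
  (forall i, continuous (fun x => f x i 0)) ->
  (forall i, continuous (fun x => g x i 0)) ->
  continuous (fun x => dot (f x) (g x)).
Proof.
move=> cf cg; apply: continuous_big => [|i _].
  by move=> -[a b]; apply: cvgD; [exact: cvg_fst|exact: cvg_snd].
by move=> x; exact: (cvgM (cf i x) (cg i x)).
Qed.

End InnerProduct.

(** * Continuity and compactness in the entrywise topology *)

Lemma nonexpansive_continuous (R : realType) (n : nat)
    (M : 'cV[R]_n -> 'cV[R]_n) :
  (forall x y, enorm (M x - M y) <= enorm (x - y)) -> continuous M.
Proof.
move=> Mle x A /= /(nbhs_ballP (M x))[e e0 eA]; apply/nbhs_ballP.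
(* Passing from entries to [enorm] costs a factor [n.+1]; halving [e] turns the resulting large
   inequality into a strict one. *)
have d0 : 0 < e / 2 / n.+1%:R by rewrite !divr_gt0.
exists (e / 2 / n.+1%:R) => //= y [_ xy]; apply: eA; split=> // i j.
rewrite ord1 /ball /=.
have := coord_le_enorm (M x - M y) i; rewrite !mxE => /le_lt_trans; apply.
apply: (le_lt_trans (Mle x y)).
apply: (@le_lt_trans _ _ (n.+1%:R * (e / 2 / n.+1%:R))).
  apply: enorm_le_coord => [|k]; first exact: ltW.
  by have := xy k 0; rewrite !mxE => /ltW.
by rewrite mulrC divfK// ltr_pdivrMr// mulr_natr mulr2n ltrDl.
Qed.

Lemma trmx_continuous (R : realType) (m n : nat) :
  continuous (fun x : 'M[R]_(m, n) => x^T).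
Proof.
move=> x A /= /(nbhs_ballP x^T)[e e0 eA]; apply/nbhs_ballP.
exists e => //= y [_ xy]; apply: eA; split=> // i j.
by rewrite !mxE; exact: xy.
Qed.

(** The box is the transpose of a product of segments, to which [rV_compact] applies. *)
Lemma cV_box_compact (R : realType) (n : nat) (c : 'cV[R]_n) (r : R) :
  compact [set x : 'cV[R]_n | forall i, `|x i 0 - c i 0| <= r].
Proof.
pose I i := `[c i 0 - r, c i 0 + r]%classic.
rewrite (_ : mkset _ =
    trmx @` [set x : 'rV[R]_n | forall i, I i (x ord0 i)]).
  apply: continuous_compact.
    by apply: continuous_subspaceT; exact: trmx_continuous.
  by apply: rV_compact => i; exact: segment_compact.
apply/seteqP; split=> [x xr|_ [x xI <-] i].
  exists x^T; last exact: trmxK.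
  by move=> i; rewrite /I /= mxE in_itv /= -ler_distl.
by have := xI i; rewrite /I /= mxE in_itv /= -ler_distl.
Qed.

(** * Projection onto a nonempty closed convex set *)

Section Projection.
Variables (R : realType) (n : nat) (C : set 'cV[R]_n).
Hypothesis C_neq0 : C !=set0.
Hypothesis C_closed : closed C.
Hypothesis C_convex : forall x y t, C x -> C y -> 0 <= t <= 1 ->
  C (x + t *: (y - x)).

(** Fix [z] in [C]. Points of [C] at least as close to [x] as [z] lie in a compact box, where the
    squared distance attains its minimum; the other points are beaten by [z]. *)
Lemma argmin_enorm_neq0 x : argmin C (fun y => enorm (y - x)) !=set0.
Proof.
have [z Cz] := C_neq0.
pose B := [set y : 'cV[R]_n | forall i, `|y i 0 - x i 0| <= enorm (z - x)].
have Bz y : enorm (y - x) <= enorm (z - x) -> B y.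
  by move=> yz i; apply: le_trans yz; have := coord_le_enorm (y - x) i; rewrite !mxE.
have CBc : compact (C `&` B).
  apply: (subclosed_compact _ (@cV_box_compact _ _ x (enorm (z - x)))).
    apply: closedI => //; apply: compact_closed (@cV_box_compact _ _ _ _).
    exact: norm_hausdorff.
  by move=> y [].
have cf : continuous (fun y : 'cV[R]_n => dot (y - x) (y - x)).
  have cc i : continuous (fun y : 'cV[R]_n => (y - x) i 0).
    rewrite (_ : (fun _ => _) = (fun y : 'cV[R]_n => y i 0 - x i 0)).
      move=> y; exact: (cvgB (@coord_continuous _ _ _ i 0 y) (cvg_cst _)).
    by apply/funext => y; rewrite !mxE.
  exact: continuous_dot.
have [|p /set_mem[Cp Bp] pmin] := compact_EVT_min _ CBc (continuous_subspaceT cf).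
  by exists z; split => //; exact: Bz.
exists p; split=> // y Cy.
have [yz|/ltW zy] := leP (enorm (y - x)) (enorm (z - x)).
  by rewrite le_enorm; apply/pmin/mem_set; split=> //; exact: Bz.
apply: le_trans zy; rewrite le_enorm; apply/pmin/mem_set.
by split=> //; exact: Bz.
Qed.

Lemma proj_argmin x : argmin C (fun y => enorm (y - x)) (proj C x).
Proof. exact: (xgetPex _ (argmin_enorm_neq0 x)). Qed.

(** Were the angle acute, a short move from the projection towards [z] would stay in [C] and come
    closer to [x]. *)
Lemma proj_obtuse x z : C z -> dot (x - proj C x) (z - proj C x) <= 0.
Proof.
move=> Cz; have [Cp pmin] := proj_argmin x; set p := proj C x in Cp pmin *.
set w := x - p; set u := z - p.
rewrite leNgt; apply/negP; set a := dot w u => a0.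
have b0 := dot_ge0 u; set b := dot u u in b0.
(* Dividing by [a + b] rather than [b] avoids a separate case [b = 0]. *)
have ab0 : 0 < a + b by lra.
(* [t] is small enough that [p + t (z - p)] is closer to [x] than [p] *)
pose t := a / (a + b).
have t01 : 0 <= t <= 1.
  by rewrite (divr_ge0 (ltW a0) (ltW ab0)) ler_pdivrMr// mul1r lerDl.
have := pmin _ (C_convex Cp Cz t01); rewrite le_enorm.
have -> : p + t *: u - x = t *: u - w.
  by apply/matrixP => i j; rewrite /w !mxE; ring.
have -> : p - x = - w by rewrite opprB.
clearbody u w; rewrite !dot_linear (dotC u w) -/a -/b => h.
(* Minimality of [p], expanded; it is contradicted by [t * b <= a < 2 * a]. *)
have : 0 <= t * (t * b - 2 * a) by move: h; lra.
have t0 : 0 < t by rewrite divr_gt0.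
rewrite pmulr_rge0// subr_ge0 leNgt => /negP; apply.
rewrite /t mulrAC ltr_pdivrMr//; nra.
Qed.

(** Add the two obtuse-angle inequalities, each taken at the projection of the other point. *)
Lemma proj_firmly_nonexpansive x y :
  dot (proj C x - proj C y) (proj C x - proj C y)
  <= dot (proj C x - proj C y) (x - y).
Proof.
have := proj_obtuse x (proj_argmin y).1.
have := proj_obtuse y (proj_argmin x).1.
set p := proj C x; set q := proj C y.
rewrite !dot_linear (dotC x q) (dotC x p) (dotC y q) (dotC y p) (dotC q p); lra.
Qed.

(** For [C := core v] this is convertible to [player_op]. *)
Definition relaxed_proj beta x := (1 - beta) *: proj C x + beta *: overproj C x.

Definition residual x := x - proj C x.

Lemma relaxed_proj_defect beta x y : 0 <= beta ->
  dot (relaxed_proj beta x - relaxed_proj beta y)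
      (relaxed_proj beta x - relaxed_proj beta y)
  <= dot (x - y) (x - y) - (1 - beta ^+ 2) *
     dot (residual x - residual y) (residual x - residual y).
Proof.
move=> b0; have := proj_firmly_nonexpansive x y.
have -> : relaxed_proj beta x - relaxed_proj beta y =
    (1 + beta) *: (proj C x - proj C y) - beta *: (x - y).
  by apply/matrixP => i j; rewrite /relaxed_proj /overproj !mxE; ring.
have -> : residual x - residual y = (x - y) - (proj C x - proj C y).
  by apply/matrixP => i j; rewrite /residual !mxE; ring.
move: (proj C x - proj C y) (x - y) => u w.
rewrite !dot_linear (dotC w u); set U := dot u u; set D := dot u w.
set W := dot w w; move=> UD.
(* The right side of the goal minus its left side is exactly twice this product. *)
have : 0 <= (1 + beta) * (D - U) by rewrite mulr_ge0 ?subr_ge0// addr_ge0.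
nra.
Qed.

End Projection.

(** * The core is closed and convex *)

Section Core.
Variables (R : realType) (N : nat) (v : tu_game R N).

Lemma core_closed : closed (core v).
Proof.
(* A general [P] covers both the grand coalition and every [S]. *)
have csum (P : pred 'I_N) :
    continuous (fun x : 'cV[R]_N => \sum_(i < N | P i) x i 0).
  apply: continuous_big => [|i _]; last exact: coord_continuous.
  by move=> -[a b]; apply: cvgD; [exact: cvg_fst|exact: cvg_snd].
rewrite (_ : core v =
    (fun x : 'cV[R]_N => \sum_(i < N) x i 0) @^-1`
      [set a | a = v (finset.setTfor 'I_N)] `&`
    \bigcap_(S in [set: {set 'I_N}]) ((fun x : 'cV[R]_N => \sum_(i in S) x i 0) @^-1`
      [set a | v S <= a])).
  apply: closedI; last apply: closed_bigI => S _.
    by apply: closed_comp => [x _|]; [exact: csum|exact: closed_eq].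
  by apply: closed_comp => [x _|]; [exact: csum|exact: closed_ge].
apply/seteqP; split=> x [x1 x2]; split=> // S; first by move=> _; exact: x2.
exact: x2.
Qed.

Lemma core_convex x y t : core v x -> core v y -> 0 <= t <= 1 ->
  core v (x + t *: (y - x)).
Proof.
have sumE (P : pred 'I_N) : \sum_(i < N | P i) (x + t *: (y - x)) i 0 =
    (1 - t) * \sum_(i < N | P i) x i 0 + t * \sum_(i < N | P i) y i 0.
  rewrite !mulr_sumr -big_split; apply: eq_bigr => i _ /=.
  by rewrite !mxE; ring.
move=> [xT xS] [yT yS] /andP[t0 t1]; split=> [|S]; rewrite sumE.
  by rewrite xT yT; ring.
by have := xS S; have := yS S; nra.
Qed.

End Core.

(** * Blockwise estimates for the joint operator, and its fixed points *)

Lemma blockB (R : realType) (N : nat) (x y : 'cV[R]_(N * N)) (i : 'I_N) :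
  block (x - y) i = block x i - block y i.
Proof. by apply/matrixP => j k; rewrite !mxE. Qed.

Lemma dot_block (R : realType) (N : nat) (x : 'cV[R]_(N * N)) :
  dot x x = \sum_(i < N) dot (block x i) (block x i).
Proof.
rewrite /dot pair_bigA /=.
(* Indices of the stacked vector correspond to pairs (block, entry). *)
rewrite (reindex _ (curry_mxvec_bij N N))/=.
by apply: eq_bigr => -[i j] _; rewrite !mxE.
Qed.

Lemma joint_op_defect (R : realType) (N : nat) (v : tu_game R N) (beta : R)
    (x y : 'cV[R]_(N * N)) : core v !=set0 -> 0 <= beta ->
  dot (joint_op v beta x - joint_op v beta y)
      (joint_op v beta x - joint_op v beta y)
  <= dot (x - y) (x - y) - (1 - beta ^+ 2) * \sum_(i < N)
     dot (residual (core v) (block x i) - residual (core v) (block y i))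
         (residual (core v) (block x i) - residual (core v) (block y i)).
Proof.
move=> v0 b0; rewrite !dot_block mulr_sumr -sumrB; apply: ler_sum => i _.
rewrite !blockB !stackK; apply: relaxed_proj_defect => //.
  exact: core_closed.
exact: core_convex.
Qed.

(** The displacement [w - player_op v beta i w] is [1 + beta] times the residual, and [1 + beta] is
    nonzero. *)
Lemma player_op_fixP (R : realType) (N : nat) (v : tu_game R N) (beta : R) i w :
  0 <= beta -> w = player_op v beta i w <-> residual (core v) w = 0.
Proof.
move=> b0; have b1 : 1 + beta != 0 by rewrite lt0r_neq0// ltr_wpDr.
have E : w - player_op v beta i w = (1 + beta) *: residual (core v) w.
  by apply/matrixP => j k; rewrite /residual /player_op /overproj !mxE; ring.
split=> [/eqP|/eqP h].
  by rewrite -subr_eq0 E scaler_eq0 (negbTE b1) => /eqP.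
by apply/eqP; rewrite -subr_eq0 E scaler_eq0 h orbT.
Qed.

Lemma joint_op_fixP (R : realType) (N : nat) (v : tu_game R N) (beta : R) x :
  0 <= beta -> fix_set (joint_op v beta) x <->
  forall i, residual (core v) (block x i) = 0.
Proof.
move=> b0; split=> [xE i|x0].
  apply/(player_op_fixP v i _ b0).
  by rewrite {1}xE stackK.
rewrite /fix_set /= /joint_op -[LHS]blockK; congr stack; apply/funext => i.
exact/(player_op_fixP v i _ b0).
Qed.

Theorem theorem1 (R : realType) (N : nat) (v : tu_game R N) (beta : R)
    (core_nonempty : core v !=set0) (beta_range : 0 <= beta < 1) :
  paracontraction (@enorm R (N * N)) (joint_op v beta).
Proof.
have /andP[b0 b1] := beta_range.
(* Here [beta < 1] enters: it makes the defect count strictly. *)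
have b2 : 0 < 1 - beta ^+ 2 by nra.
split=> [|x y xNfix yfix].
  apply: nonexpansive_continuous => x y; rewrite le_enorm.
  apply: le_trans (joint_op_defect _ _ core_nonempty b0) _.
  by rewrite gerBl (mulr_ge0 (ltW b2))// sumr_ge0// => i _; exact: dot_ge0.
(* Only the left-hand [y] becomes its image, giving the shape of [joint_op_defect]. *)
apply: lt_enorm; rewrite {1 2}yfix.
apply: le_lt_trans (joint_op_defect _ _ core_nonempty b0) _.
rewrite gtrBl mulr_gt0// lt_def sumr_ge0 ?andbT; last by move=> *; exact: dot_ge0.
(* A zero defect makes every term vanish; as the residuals of [y] are zero, so are those of [x],
   which would then be fixed. *)
apply/negP; rewrite psumr_eq0 => [/allP h|*]; last exact: dot_ge0.
apply: xNfix; apply/(joint_op_fixP v x b0) => i.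
have := h i (mem_index_enum i).
rewrite /= ((joint_op_fixP v y b0).1 yfix i) subr0 => /eqP.
exact: dot_eq0.
Qed.
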